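(* Let $n\ge1$, let $H\in\mathbb{R}^{n\times n}$ be symmetric positive definite with symmetric positive-definite square root $H^{1/2}$, let $\delta>0$, $a\in\mathbb{R}$, $b\in\mathbb{R}^n$, and $\beta=\sqrt{b^{\mathsf T}H^{-1}b}$. Consider the primal problem $$(P_{a,b}^{\delta,H})\qquad\inf\{at+b^{\mathsf T}z:\ (t,z)\in\mathbb{R}\times\mathbb{R}^n,\ (t,H^{1/2}z,\delta)\in\mathcal Q^{n+2}\}$$ and its Lagrange dual $(D_{a,b}^{\delta,H})$ (defined in the context). The primal problem satisfies Slater's condition for every objective $(a,b)$. If $a\ge\beta$, the dual has the unique solution $y^*=\left(a,H^{-1/2}b,-\sqrt{a^2-\beta^2}\right)$ and $$\operatorname{val}(D_{a,b}^{\delta,H})=\delta\sqrt{a^2-\beta^2}=\operatorname{val}(P_{a,b}^{\delta,H}).$$ At the boundary $a=\beta>0$, the dual optimum is attained at $y^*=(\beta,H^{-1/2}b,0)$, while the primal optimum does not exist (the primal infimum is not attained).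
   Context: $\mathcal Q^{n+2}=\{(y_0,\bar y)\in\mathbb{R}\times\mathbb{R}^{n+1}: y_0\ge\|\bar y\|\}$ is the Lorentz cone (Euclidean norm). The primal feasible set equals $\{(t,z): t\ge\sqrt{\delta^2+z^{\mathsf T}Hz}\}$. Write $A(t,z)=(t,H^{1/2}z,0)$ and $\omega_\delta=(0,0,-\delta)$ in $\mathbb{R}\times\mathbb{R}^n\times\mathbb{R}$, so the constraint reads $A(t,z)-\omega_\delta\in\mathcal Q^{n+2}$. The dual is $$(D_{a,b}^{\delta,H})\qquad\sup\{\langle\omega_\delta,y\rangle:\ y\in\mathcal Q^{n+2},\ A^{\mathsf T}y=(a,b)\}.$$ Dual variables are written $y=(y_0,\bar y,\upsilon)\in\mathbb{R}\times\mathbb{R}^n\times\mathbb{R}$. Slater's condition means that there is $(t,z)$ with $A(t,z)-\omega_\delta\in\operatorname{int}\mathcal Q^{n+2}$. $\operatorname{val}$ denotes the optimal value. *)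

(* Defs.v *)
From HB Require Import structures.
From mathcomp Require Export all_boot all_order all_algebra.
From mathcomp Require Export all_classical all_reals all_analysis.

Set Implicit Arguments.
Unset Strict Implicit.
Unset Printing Implicit Defensive.

Import Order.TTheory GRing.Theory Num.Theory.
Import numFieldNormedType.Exports.

Local Open Scope classical_set_scope.
Local Open Scope ring_scope.

(* The norm `|x| of MathComp-Analysis on 'cV[R]_m is the sup norm, hence the
   explicit Euclidean structure below. *)
Definition dot (R : realType) (m : nat) (u v : 'cV[R]_m) : R := (u^T *m v) 0 0.

Definition enorm (R : realType) (m : nat) (u : 'cV[R]_m) : R :=
  Num.sqrt (dot u u).

Definition posdef (R : realType) (n : nat) (M : 'M[R]_n) : Prop :=
  M^T = M /\ forall x : 'cV[R]_n, x != 0 -> 0 < dot x (M *m x).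

(* S = H^{1/2}; such an S is unique when H is positive definite. *)
Definition posdef_sqrt (R : realType) (n : nat) (H S : 'M[R]_n) : Prop :=
  posdef S /\ S *m S = H.

(* The space R x R^m is encoded as 'cV[R]_(1 + m), so that A and its adjoint
   are a matrix and its transpose. *)
Definition lorentz_cone (R : realType) (m : nat) : set 'cV[R]_(1 + m) :=
  [set y | enorm (dsubmx y) <= usubmx y 0 0].

(* (t, z) in R x R^n *)
Definition pvec (R : realType) (n : nat) (t : R) (z : 'cV[R]_n) :
  'cV[R]_(1 + n) := col_mx t%:M z.

(* (y0, ybar, v) in R x R^n x R *)
Definition dvec (R : realType) (n : nat) (y0 : R) (ybar : 'cV[R]_n) (v : R) :
  'cV[R]_(1 + (n + 1)) := col_mx y0%:M (col_mx ybar v%:M).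

Definition opA (R : realType) (n : nat) (S : 'M[R]_n) :
  'M[R]_(1 + (n + 1), 1 + n) := block_mx 1%:M 0 0 (col_mx S 0).

Lemma opAE (R : realType) (n : nat) (S : 'M[R]_n) (t : R) (z : 'cV[R]_n) :
  opA S *m pvec t z = dvec t (S *m z) 0.
Proof.
rewrite /opA /pvec /dvec mul_block_col mul1mx !mul0mx addr0 add0r mul_col_mx.
by rewrite mul0mx raddf0.
Qed.

Definition omega (R : realType) (n : nat) (delta : R) : 'cV[R]_(1 + (n + 1)) :=
  dvec 0 0 (- delta).

Definition slater (R : realType) (n : nat) (S : 'M[R]_n) (delta : R) : Prop :=
  exists (t : R) (z : 'cV[R]_n),
    interior (@lorentz_cone R (n + 1)) (opA S *m pvec t z - omega n delta).

Definition primal_feasible (R : realType) (n : nat) (S : 'M[R]_n) (delta : R) :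
  set (R * 'cV[R]_n) :=
  [set x | lorentz_cone (dvec x.1 (S *m x.2) delta)].

Definition primal_obj (R : realType) (n : nat) (a : R) (b : 'cV[R]_n)
  (x : R * 'cV[R]_n) : R := a * x.1 + dot b x.2.

Definition primal_val (R : realType) (n : nat) (S : 'M[R]_n) (delta a : R)
  (b : 'cV[R]_n) : \bar R :=
  ereal_inf [set (primal_obj a b x)%:E | x in primal_feasible S delta].

Definition primal_solution (R : realType) (n : nat) (S : 'M[R]_n) (delta a : R)
  (b : 'cV[R]_n) (x : R * 'cV[R]_n) : Prop :=
  primal_feasible S delta x /\
  forall x', primal_feasible S delta x' -> primal_obj a b x <= primal_obj a b x'.

Definition dual_feasible (R : realType) (n : nat) (S : 'M[R]_n) (a : R)
  (b : 'cV[R]_n) : set 'cV[R]_(1 + (n + 1)) :=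
  [set y | lorentz_cone y /\ (opA S)^T *m y = pvec a b].

Definition dual_val (R : realType) (n : nat) (S : 'M[R]_n) (delta a : R)
  (b : 'cV[R]_n) : \bar R :=
  ereal_sup [set (dot (omega n delta) y)%:E | y in dual_feasible S a b].

Definition dual_solution (R : realType) (n : nat) (S : 'M[R]_n) (delta a : R)
  (b : 'cV[R]_n) (y : 'cV[R]_(1 + (n + 1))) : Prop :=
  dual_feasible S a b y /\
  forall y', dual_feasible S a b y' ->
    dot (omega n delta) y' <= dot (omega n delta) y.

(* Main.v *)
Require Import Defs.
From mathcomp Require Import ring lra.

Set Implicit Arguments.
Unset Strict Implicit.
Unset Printing Implicit Defensive.

Import Order.TTheory GRing.Theory Num.Theory.
Import numFieldNormedType.Exports.
Local Open Scope classical_set_scope.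
Local Open Scope ring_scope.

(** Substituting w = S z and c = S^-1 b turns the objective into a t + c.w,
    with |c| = beta.  Dual feasibility leaves only the last coordinate v free,
    subject to v^2 <= s^2 := a^2 - beta^2, which settles the dual.  Weak
    duality is self-duality of the cone.  For the primal infimum, every
    sigma > 0 with sigma >= s gives the feasible point
    w = - (delta / sigma) c, t = (delta / sigma) sqrt(beta^2 + sigma^2),
    whose objective is at most delta sigma; this covers the attained and the
    boundary cases at once.  When a = beta > 0, the Cauchy-Schwarz bound
    is strict because delta > 0, so the infimum 0 is not attained. *)

(** * Euclidean inner product *)

Lemma dotE (R : realType) (m : nat) (u v : 'cV[R]_m) :
  dot u v = \sum_i u i 0 * v i 0.
Proof. by rewrite /dot mxE; apply: eq_bigr => i _; rewrite mxE. Qed.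

Lemma dotC (R : realType) (m : nat) (u v : 'cV[R]_m) : dot u v = dot v u.
Proof. by rewrite !dotE; apply: eq_bigr => i _; rewrite mulrC. Qed.

Lemma dotDr (R : realType) (m : nat) (u v w : 'cV[R]_m) :
  dot u (v + w) = dot u v + dot u w.
Proof. by rewrite /dot mulmxDr mxE. Qed.

Lemma dotZr (R : realType) (m : nat) (k : R) (u v : 'cV[R]_m) :
  dot u (k *: v) = k * dot u v.
Proof. by rewrite /dot -scalemxAr mxE. Qed.

Lemma dot0r (R : realType) (m : nat) (u : 'cV[R]_m) : dot u 0 = 0.
Proof. by rewrite /dot mulmx0 mxE. Qed.

Lemma dot_ge0 (R : realType) (m : nat) (u : 'cV[R]_m) : 0 <= dot u u.
Proof. by rewrite dotE sumr_ge0// => i _; rewrite -expr2 sqr_ge0. Qed.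

Lemma dot_mulmx (R : realType) (m p : nat) (M : 'M[R]_(m, p)) u v :
  dot u (M *m v) = dot (M^T *m u) v.
Proof. by rewrite /dot trmx_mul trmxK mulmxA. Qed.

Lemma dot_col_mx (R : realType) (m p : nat) (u u' : 'cV[R]_m)
    (v v' : 'cV[R]_p) :
  dot (col_mx u v) (col_mx u' v') = dot u u' + dot v v'.
Proof. by rewrite /dot tr_col_mx mul_row_col mxE. Qed.

Lemma dot_scalar (R : realType) (x y : R) :
  dot (x%:M : 'cV[R]_1) y%:M = x * y.
Proof. by rewrite dotE big_ord1 !mxE eqxx. Qed.

Lemma dot_eq0 (R : realType) (m : nat) (u : 'cV[R]_m) :
  (dot u u == 0) = (u == 0).
Proof.
apply/eqP/eqP => [|->]; last by rewrite dot0r.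
rewrite dotE => /psumr_eq0P u0; apply/matrixP => i j; rewrite ord1 mxE.
apply/eqP; rewrite -sqrf_eq0 expr2 u0// => k _.
by rewrite -expr2 sqr_ge0.
Qed.

Lemma dot_sqr_le (R : realType) (m : nat) (u v : 'cV[R]_m) :
  dot u v ^+ 2 <= dot u u * dot v v.
Proof.
have [->|v0] := eqVneq v 0; first by rewrite !dot0r expr0n mulr0.
have vv : 0 < dot v v by rewrite lt_def dot_eq0 v0 dot_ge0.
(* Expanded, this square is [dot v v * (dot u u * dot v v - dot u v ^+ 2)]. *)
have := dot_ge0 (dot v v *: u + (- dot u v) *: v).
rewrite !dotDr !dotZr ![dot (_ + _) _]dotC !dotDr !dotZr (dotC v u) => h.
rewrite -subr_ge0 -(pmulr_rge0 _ vv).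
by apply: le_trans h _; rewrite le_eqVlt; apply/orP; left; apply/eqP; ring.
Qed.

(** * Lorentz cone *)

Lemma sqrt_le_iff (R : realType) (x y : R) : 0 <= x ->
  Num.sqrt x <= y <-> 0 <= y /\ x <= y ^+ 2.
Proof.
move=> x0; split=> [h|[y0 h]].
  have y0 := le_trans (sqrtr_ge0 _) h; split=> //.
  by rewrite -(sqr_sqrtr x0) ler_pXn2r ?nnegrE ?sqrtr_ge0.
by rewrite -(ger0_norm y0) -sqrtr_sqr ler_wsqrtr.
Qed.

Lemma lorentz_dvecP (R : realType) (n : nat) (t v : R) (w : 'cV[R]_n) :
  lorentz_cone (dvec t w v) <-> 0 <= t /\ dot w w + v ^+ 2 <= t ^+ 2.
Proof.
rewrite /lorentz_cone /dvec /enorm /= col_mxKd col_mxKu dot_col_mx dot_scalar.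
rewrite mxE eqxx -expr2; apply: sqrt_le_iff.
by rewrite addr_ge0 ?dot_ge0 ?sqr_ge0.
Qed.

(** Cauchy-Schwarz bounds the inner product of the tails, in absolute value, by the product of the
    heads. This is the half of self-duality behind weak duality. *)
Lemma lorentz_dot_ge0 (R : realType) (m : nat) (x y : 'cV[R]_(1 + m)) :
  lorentz_cone x -> lorentz_cone y -> 0 <= dot x y.
Proof.
rewrite /lorentz_cone /enorm /= => hx hy.
have [x0 xx] := (sqrt_le_iff _ (dot_ge0 _)).1 hx.
have [y0 yy] := (sqrt_le_iff _ (dot_ge0 _)).1 hy.
rewrite -[x]vsubmxK -[y]vsubmxK dot_col_mx dotE big_ord1.
have := dot_sqr_le (dsubmx x) (dsubmx y).
move/le_trans/(_ (ler_pM (dot_ge0 _) (dot_ge0 _) xx yy)).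
rewrite -exprMn -ler_sqrt ?sqr_ge0// !sqrtr_sqr (ger0_norm (mulr_ge0 x0 y0)).
by rewrite ler_norml => /andP[+ _]; lra.
Qed.

(** The gap between head and tail norm is continuous, so it stays positive near [y]. *)
Lemma interior_lorentz (R : realType) (m : nat) (y : 'cV[R]_(1 + m)) :
  enorm (dsubmx y) < usubmx y 0 0 -> interior (@lorentz_cone R m) y.
Proof.
pose f (x : 'cV[R]_(1 + m)) : R := usubmx x 0 0 - enorm (dsubmx x).
move=> hy; have fy : 0 < f y by rewrite subr_gt0.
have fc : {for y, continuous f}.
  have cc i : continuous (fun x : 'cV[R]_(1 + m) => x i 0).
    exact: coord_continuous.
  (* The topology comes from the sup norm, so continuity of the Euclidean norm is derived from that
     of the coordinates. *)
  have -> : f = fun x => x (lshift m 0) 0 -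
      Num.sqrt (\sum_i x (rshift 1 i) 0 * x (rshift 1 i) 0).
    apply/funext => x; rewrite /f /enorm dotE mxE; congr (_ - Num.sqrt _).
    by apply: eq_bigr => i _; rewrite mxE.
  apply: (continuousB (cc _ _)).
  apply: continuous_comp; last exact: sqrt_continuous.
  apply: continuous_big => [|i _ x]; first exact: add_continuous.
  by apply: (continuousM (cc _ _)); exact: cc.
have : \forall x \near y, 0 < f x.
  exact: (fc _ (lt_nbhsr fy)).
by apply: filterS => x; rewrite subr_gt0 => /ltW.
Qed.

Lemma posdef_unitmx (R : realType) (n : nat) (S : 'M[R]_n) :
  posdef S -> S \in unitmx.
Proof.
move=> [ST Spos]; rewrite unitmxE unitfE; apply/det0P => -[v v0 vS].
have := Spos v^T; rewrite trmx_eq0 => /(_ v0).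
by rewrite -[S in S *m _]ST -trmx_mul vS trmx0 dot0r ltxx.
Qed.

Lemma omegaE (R : realType) (n : nat) (delta y0 v : R) (w : 'cV[R]_n) :
  dot (omega n delta) (dvec y0 w v) = - (delta * v).
Proof.
rewrite /omega /dvec !dot_col_mx !dot_scalar [dot 0 _]dotC dot0r.
by rewrite mul0r !add0r mulNr.
Qed.

Lemma slater_pos (R : realType) (n : nat) (S : 'M[R]_n) (delta : R) :
  0 < delta -> slater S delta.
Proof.
(* The shifted point is [(delta + 1, 0, delta)], whose tail has norm [delta]. *)
move=> d0; exists (delta + 1), 0; apply: interior_lorentz.
rewrite opAE mulmx0 /omega /dvec !opp_col_mx !add_col_mx col_mxKu col_mxKd.
rewrite /enorm -!raddfB/= !subr0 sub0r opprK dot_col_mx dot0r dot_scalar add0r.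
by rewrite -expr2 sqrtr_sqr gtr0_norm// mxE eqxx mulr1n ltrDl.
Qed.

(** * Primal and dual with [H] eliminated, for [beta <= a] *)

Section ReducedProblem.
Variables (R : realType) (n : nat) (S : 'M[R]_n) (delta a beta : R).
Variable b : 'cV[R]_n.
Hypotheses (S_sym : S^T = S) (S_unit : S \in unitmx) (delta_gt0 : 0 < delta).
Hypothesis dot_c : dot (invmx S *m b) (invmx S *m b) = beta ^+ 2.
Hypotheses (beta_ge0 : 0 <= beta) (le_beta_a : beta <= a).

Local Notation c := (invmx S *m b).
Local Notation s := (Num.sqrt (a ^+ 2 - beta ^+ 2)).

Let a_ge0 : 0 <= a. Proof. exact: le_trans le_beta_a. Qed.

Let s_sqr : s ^+ 2 = a ^+ 2 - beta ^+ 2.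
Proof. by rewrite sqr_sqrtr// subr_ge0 ler_pXn2r. Qed.

Let s_ge0 : 0 <= s. Proof. exact: sqrtr_ge0. Qed.

Lemma primal_objE x : primal_obj a b x = a * x.1 + dot c (S *m x.2).
Proof. by rewrite /primal_obj dot_mulmx S_sym mulKVmx. Qed.

Lemma dual_feasibleP y :
  dual_feasible S a b y <-> exists2 v, y = dvec a c v & v ^+ 2 <= s ^+ 2.
Proof.
have eqA y0 w v : (opA S)^T *m dvec y0 w v = pvec y0 (S *m w).
  rewrite /opA /pvec /dvec tr_block_mx !trmx0 trmx1 tr_col_mx S_sym trmx0.
  by rewrite mul_block_col mul_row_col mul1mx !mul0mx !addr0 add0r.
rewrite s_sqr; split=> [[yc]|[v -> hv]].
  have yE : y = dvec (usubmx y 0 0) (usubmx (dsubmx y)) (dsubmx (dsubmx y) 0 0).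
    by rewrite /dvec -!mx11_scalar !vsubmxK.
  rewrite [in X in X -> _]yE eqA => /eq_col_mx[/matrixP/(_ 0 0)].
  rewrite [X in X = _]mxE [X in _ = X]mxE eqxx !mulr1n => y0 ySb.
  (* The adjoint constraint on the middle block reads [S *m w = b]; inverting [S] gives [w = c]. *)
  move: yE; rewrite y0 -(mulKmx S_unit (usubmx (dsubmx y))) ySb.
  move: (dsubmx (dsubmx y) 0 0) => v yE; exists v => //.
  by move: yc; rewrite yE => /lorentz_dvecP[_]; rewrite dot_c addrC lerBrDr.
split; last by rewrite eqA mulKVmx.
by apply/lorentz_dvecP; split=> //; rewrite dot_c addrC -lerBrDr.
Qed.

Lemma dual_opt_feasible : dual_feasible S a b (dvec a c (- s)).
Proof. by apply/dual_feasibleP; exists (- s); rewrite ?sqrrN. Qed.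

Lemma dual_obj_le y : dual_feasible S a b y ->
  dot (omega n delta) y <= delta * s.
Proof.
move=> /dual_feasibleP[v -> hv]; rewrite omegaE -mulrN ler_pM2l//.
by move: (s) s_ge0 hv => r; nra.
Qed.

Lemma dual_solutionP y :
  dual_solution S delta a b y <-> y = dvec a c (- s).
Proof.
split=> [[/dual_feasibleP[v -> hv] /(_ _ dual_opt_feasible)]|->].
  (* Comparison with the candidate gives [v <= - s], and [v ^+ 2 <= s ^+ 2] forces equality. *)
  rewrite !omegaE lerN2 ler_pM2l// => vs; congr dvec.
  by move: (s) s_ge0 hv vs => r; nra.
split=> [|y' /dual_obj_le]; first exact: dual_opt_feasible.
by rewrite omegaE mulrN opprK.
Qed.

Lemma dual_valE : dual_val S delta a b = (delta * s)%:E.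
Proof.
apply/eqP; rewrite eq_le; apply/andP; split.
  by apply: ge_ereal_sup => _ [y /dual_obj_le hy <-]; rewrite lee_fin.
apply: ereal_sup_ubound; exists (dvec a c (- s)); first exact: dual_opt_feasible.
by rewrite omegaE mulrN opprK.
Qed.

(** Pairing a primal point with the dual optimum [(a, c, - s)] gives exactly the objective minus
    [delta * s]. *)
Lemma primal_obj_ge x : primal_feasible S delta x ->
  delta * s <= primal_obj a b x.
Proof.
have [yc _] := dual_opt_feasible.
move=> /lorentz_dot_ge0/(_ yc); rewrite primal_objE /dvec !dot_col_mx !dot_scalar.
by rewrite mulrN addrA subr_ge0 (dotC c) (mulrC a).
Qed.

Lemma primal_near_opt sigma : 0 < sigma -> s <= sigma ->
  exists2 x, primal_feasible S delta x & primal_obj a b x <= delta * sigma.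
Proof.
move=> sg0 ssg; set k := delta / sigma; set r := Num.sqrt (beta ^+ 2 + sigma ^+ 2).
have k0 : 0 <= k by rewrite divr_ge0 ?ltW.
have kd : k * sigma = delta by rewrite divfK// gt_eqF.
have r2 : r ^+ 2 = beta ^+ 2 + sigma ^+ 2 by rewrite sqr_sqrtr// addr_ge0 ?sqr_ge0.
have r0 : 0 <= r := sqrtr_ge0 _.
(* This is the exact minimiser, of value [delta * sigma], when [a] is raised to [r]. Since [a <= r]
   and [t >= 0], returning to [a] cannot increase the objective. *)
exists (k * r, invmx S *m ((- k) *: c)).
  apply/lorentz_dvecP; rewrite /= mulKVmx// mulr_ge0//; split=> //.
  by rewrite dotZr dotC dotZr dot_c exprMn r2 -kd; lra.
have ar : a <= r.
  rewrite -(ler_pXn2r (n := 2))// r2 -lerBlDl -s_sqr.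
  by rewrite ler_pXn2r ?nnegrE ?sqrtr_ge0 ?(ltW sg0).
rewrite primal_objE /= mulKVmx// dotZr dot_c -{1}kd mulNr mulrCA.
rewrite -mulrBr -mulrA ler_wpM2l// -expr2 lerBlDl -r2 expr2.
by rewrite ler_wpM2r.
Qed.

Lemma primal_valE : primal_val S delta a b = (delta * s)%:E.
Proof.
apply/eqP; rewrite eq_le; apply/andP; split; last first.
  by apply: le_ereal_inf_tmp => _ [x /primal_obj_ge hx <-]; rewrite lee_fin.
(* The shift [e / delta] keeps [sigma] positive even if [s = 0], and raises the bound by [e]. *)
apply/lee_addgt0Pr => e e0; have ed0 : 0 < e / delta by rewrite divr_gt0.
have [||x xf hx] := @primal_near_opt (s + e / delta).
- by rewrite ltr_wpDl ?sqrtr_ge0.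
- by rewrite lerDl ltW.
rewrite mulrDr [delta * (_ / _)]mulrC divfK ?gt_eqF// in hx.
apply: (@le_trans _ _ (primal_obj a b x)%:E); last by rewrite -EFinD lee_fin.
by apply: ereal_inf_lbound; exists x.
Qed.

Lemma primal_not_attained : a = beta -> 0 < beta ->
  ~ exists x, primal_solution S delta a b x.
Proof.
move=> ab beta0 [x [xf xopt]].
have s0 : s = 0 by rewrite ab subrr sqrtr0.
have obj_le0 : primal_obj a b x <= 0.
  apply/ler_addgt0Pr => e e0; rewrite add0r.
  have [||x' /xopt h h'] := @primal_near_opt (e / delta).
  - by rewrite divr_gt0.
  - by rewrite s0 ltW// divr_gt0.
  by apply: le_trans h (le_trans h' _); rewrite mulrC divfK// gt_eqF.
case/lorentz_dvecP: xf => t0 tw.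
have cs := dot_sqr_le c (S *m x.2).
rewrite primal_objE ab dot_c in obj_le0 cs.
have bt := mulr_ge0 beta_ge0 t0.
(* A nonpositive objective means [0 <= beta * t <= - dot c w], so squaring preserves the order. *)
have : (beta * x.1) ^+ 2 <= dot c (S *m x.2) ^+ 2.
  by rewrite -[leRHS]sqrrN ler_pXn2r ?nnegrE//; lra.
(* Cancelling [beta ^+ 2] leaves [t ^+ 2 <= dot w w], against [dot w w + delta ^+ 2 <= t ^+ 2]. *)
move=> /le_trans/(_ cs); rewrite exprMn ler_pM2l ?exprn_gt0//.
by move=> /(le_trans tw); rewrite gerDl leNgt exprn_gt0.
Qed.

End ReducedProblem.

Theorem proposition7p2 (R : realType) (n : nat) (hn : (1 <= n)%N)
    (H S : 'M[R]_n) (hH : posdef H) (hS : posdef_sqrt H S)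
    (delta : R) (hdelta : 0 < delta) (a : R) (b : 'cV[R]_n)
    (beta : R) (hbeta : beta = Num.sqrt (dot b (invmx H *m b))) :
  slater S delta /\
  (beta <= a ->
     (forall y : 'cV[R]_(1 + (n + 1)),
        dual_solution S delta a b y <->
        y = dvec a (invmx S *m b) (- Num.sqrt (a ^+ 2 - beta ^+ 2))) /\
     dual_val S delta a b = (delta * Num.sqrt (a ^+ 2 - beta ^+ 2))%:E /\
     primal_val S delta a b = (delta * Num.sqrt (a ^+ 2 - beta ^+ 2))%:E) /\
  (a = beta -> 0 < beta ->
     dual_solution S delta a b (dvec beta (invmx S *m b) 0) /\
     ~ exists x : R * 'cV[R]_n, primal_solution S delta a b x).
Proof.
have [Spd SS] := hS; have Su := posdef_unitmx Spd.
have beta0 : 0 <= beta by rewrite hbeta sqrtr_ge0.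
(* The inverse of [H] is the square of the symmetric matrix [invmx S], one factor of which moves
   across the inner product. *)
have bHb : dot b (invmx H *m b) = dot (invmx S *m b) (invmx S *m b).
  have Hu : H \in unitmx by rewrite -SS unitmx_mul Su.
  have -> : invmx H *m b = invmx S *m (invmx S *m b).
    by apply: (can_inj (mulKmx Hu)); rewrite mulKVmx// -SS -mulmxA !mulKVmx.
  by rewrite dot_mulmx trmx_inv Spd.1.
have dc : dot (invmx S *m b) (invmx S *m b) = beta ^+ 2.
  by rewrite hbeta bHb sqr_sqrtr// dot_ge0.
split; first exact: slater_pos.
split=> [ba|ab b0].
  split=> [y|]; first exact: (dual_solutionP Spd.1 Su hdelta dc beta0 ba).
  by split; [exact: (dual_valE Spd.1 Su hdelta dc beta0 ba) | exact: (primal_valE Spd.1 Su hdelta dc beta0 ba)].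
have ba : beta <= a by rewrite ab.
split; last exact: (primal_not_attained Spd.1 Su hdelta dc beta0 ba).
apply/(dual_solutionP Spd.1 Su hdelta dc beta0 ba).
by rewrite ab subrr sqrtr0 oppr0.
Qed.
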